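(* Let $T:=\frac{1}{V(N)}\sum_{j_+(N)\le j<j_-(N)}\tau(n_j)$. If $\tau(n_j)$ has vanishing relative variance on the dyadic scale $N$, i.e. $\frac{1}{V(N)}\sum_{j_+(N)\le j<j_-(N)}(\tau(n_j)-T)^2=o(T^2)$, then the orbit contains a sequence \[ m_1>m_2>\cdots>m_r\ \text{ in } (N,2N],\qquad r\asymp\frac{N}{T}, \] such that $m_{i+1}=m_i-T+o(T)$ and $\tau(m_i)=T+o(T)$ for all but $o(r)$ indices $i$.
   Context: $\tau(n)$ is the number of positive divisors of $n$. Fix $x$ and the orbit $n_0=x$, $n_{j+1}=n_j-\tau(n_j)$. For $N\ge1$ let $j_+(N):=\min\{j:n_j\le2N\}$, $j_-(N):=\min\{j:n_j\le N\}$, $V(N):=j_-(N)-j_+(N)$. Asymptotic notation refers to $N\to\infty$.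
   Formalization: For fixed x and N→∞ the block (N,2N] contains no orbit point, so V(N)=0; here x may vary with N and 2N ≤ x is assumed (the orbit starts at or above the block), since e.g. x=N+1 gives V=1, zero variance and r ≤ 1, contradicting r≍N/T. *)

(* Defs.v *)
From HB Require Import structures.
From mathcomp Require Import all_boot all_order all_algebra.
From mathcomp Require Import all_classical all_reals all_analysis.

Set Implicit Arguments.
Unset Strict Implicit.
Unset Printing Implicit Defensive.

Import Order.TTheory GRing.Theory Num.Theory.
Import numFieldNormedType.Exports.

Local Open Scope ring_scope.
Local Open Scope classical_set_scope.

(* [divisors 0] is [:: 1], so [tau 0 = 1]; this value only makes 0 a fixed
   point of the (truncated) map n |-> n - tau n. *)
Definition tau (n : nat) : nat := size (divisors n).

Definition tau_orbit (x j : nat) : nat := iter j (fun n => (n - tau n)%N) x.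

Lemma tau_gt0 n : (0 < tau n)%N.
Proof.
case: n => [|n]; first by [].
have : 1%N \in divisors n.+1 by rewrite -dvdn_divisors // dvd1n.
by rewrite /tau; case: (divisors n.+1).
Qed.

Lemma tau_orbit_reaches (x M : nat) : exists j, (tau_orbit x j <= M)%N.
Proof.
have H j : (tau_orbit x j <= x - j)%N.
  elim: j => [|j IHj]; first by rewrite subn0.
  rewrite /tau_orbit iterS -/(tau_orbit x j) subnS -subn1.
  exact: (leq_sub IHj (tau_gt0 _)).
by exists x; apply: leq_trans (H x) _; rewrite subnn.
Qed.

(* min {j | n_j <= M} *)
Definition first_le (x M : nat) : nat := ex_minn (tau_orbit_reaches x M).

Definition jplus (x N : nat) : nat := first_le x (2 * N).
Definition jminus (x N : nat) : nat := first_le x N.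
Definition visits (x N : nat) : nat := (jminus x N - jplus x N)%N.

Definition tau_mean (R : realType) (x N : nat) : R :=
  (visits x N)%:R^-1 *
  \sum_(jplus x N <= j < jminus x N) (tau (tau_orbit x j))%:R.

Definition tau_var (R : realType) (x N : nat) : R :=
  (visits x N)%:R^-1 *
  \sum_(jplus x N <= j < jminus x N)
     ((tau (tau_orbit x j))%:R - tau_mean R x N) ^+ 2.

(* m_{i+1} = m_i - T and tau(m_i) = T, both up to an error e; the first
   condition is void at the last index of s, which has no successor. *)
Definition near_AP_at (R : realType) (T e : R) (s : seq nat) (i : nat) : bool :=
  ((i.+1 < size s)%N ==>
     (`|(nth 0%N s i.+1)%:R - ((nth 0%N s i)%:R - T)| <= e))
  && (`|(tau (nth 0%N s i))%:R - T| <= e).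

Definition num_exceptions (R : realType) (T e : R) (s : seq nat) : nat :=
  #|[set i : 'I_(size s) | ~~ near_AP_at T e s i]%SET|.

(* Main.v *)
(** With m the whole stretch of orbit lying in (N, 2N], the sum of tau(n_j)
    telescopes to the length of that stretch, which is of order N because tau(n)
    is at most n/3 + 2; this gives r = V(N) of order N/T.  Both conditions at an
    index i read |tau(m_i) - T| <= e, because m_{i+1} = m_i - tau(m_i); with q the
    square root of the relative variance and e = T sqrt(q), Chebyshev's inequality
    leaves at most q r exceptions. *)

Require Import Defs.
From HB Require Import structures.
From mathcomp Require Import all_boot all_order all_algebra.
From mathcomp Require Import all_classical all_reals all_analysis.
From mathcomp Require Import zify ring.

Set Implicit Arguments.
Unset Strict Implicit.
Unset Printing Implicit Defensive.

Import Order.TTheory GRing.Theory Num.Theory.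
Import numFieldNormedType.Exports.

Local Open Scope ring_scope.
Local Open Scope classical_set_scope.

(** * Upper bounds for the divisor function *)

Lemma tau_leq n : (0 < n)%N -> (tau n <= n)%N.
Proof.
move=> n0; rewrite -[leqRHS](size_iota 1).
apply: uniq_leq_size (divisors_uniq n) _ => d.
rewrite -dvdn_divisors // mem_iota => dn.
by rewrite (dvdn_gt0 n0 dn) add1n ltnS dvdn_leq.
Qed.

(** Apart from [n] and possibly [n/2], every divisor is a quotient of [n] by some [q >= 3], hence at
    most [n/3]. A bound near [n/2] would be too weak: one step from just above [2 * N] could then
    cross almost the whole block. *)
Lemma tau_leq_third n : (tau n <= n %/ 3 + 2)%N.
Proof.
case: (posnP n) => [->//|n0].
have -> : (n %/ 3 + 2)%N = size [:: n, n %/ 2 & iota 1 (n %/ 3)]%N.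
  by rewrite /= size_iota addn2.
apply: uniq_leq_size (divisors_uniq n) _ => d.
rewrite -dvdn_divisors // => dn; have d0 := dvdn_gt0 n0 dn.
case/dvdnP: dn n0 => q -> n0.
rewrite !inE mem_iota d0 add1n ltnS.
case: q n0 => [|[|[|q]]] // _.
- by rewrite mul1n eqxx.
- by rewrite mulnC mulnK // eqxx orbT.
- by rewrite leq_divRL // [X in (X <= _)%N]mulnC leq_mul2r orbT !orbT.
Qed.

(** * The orbit and its passage through the dyadic block *)

Lemma tau_orbitS x j :
  tau_orbit x j.+1 = (tau_orbit x j - tau (tau_orbit x j))%N.
Proof. by []. Qed.

Lemma tau_orbit_first_le x M : (tau_orbit x (first_le x M) <= M)%N.
Proof. by rewrite /first_le; case: ex_minnP. Qed.

Lemma tau_orbit_gt x M j : (j < first_le x M)%N -> (M < tau_orbit x j)%N.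
Proof.
rewrite /first_le; case: ex_minnP => i _ mini ji.
by rewrite ltnNge; apply/negP => /mini; rewrite leqNgt ji.
Qed.

Lemma tau_orbit_anti x i j : (i <= j)%N -> (tau_orbit x j <= tau_orbit x i)%N.
Proof.
move=> /subnK <-; elim: (j - i)%N => // k IH.
by rewrite addSn tau_orbitS (leq_trans (leq_subr _ _) IH).
Qed.

Lemma jplus_le_jminus x N : (jplus x N <= jminus x N)%N.
Proof.
rewrite leqNgt; apply/negP => /tau_orbit_gt.
by have := tau_orbit_first_le x N; rewrite /jminus; lia.
Qed.

(** Positivity gives [tau n <= n] before time [b], so the truncated subtractions are exact. *)
Lemma tau_sum_telescope x a b : (a <= b)%N ->
  (forall j, (j < b)%N -> (0 < tau_orbit x j)%N) ->
  (\sum_(a <= j < b) tau (tau_orbit x j) + tau_orbit x b = tau_orbit x a)%N.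
Proof.
move=> /subnKC <-; elim: (b - a)%N => [|k IH] pos.
  by rewrite addn0 big_geq.
rewrite addnS tau_orbitS big_nat_recr ?leq_addr //= -addnA subnKC; last first.
  by apply/tau_leq/pos; rewrite addnS.
by apply: IH => j jk; apply: pos; rewrite addnS ltnS ltnW.
Qed.

Lemma tau_sum_block x N :
  (\sum_(jplus x N <= j < jminus x N) tau (tau_orbit x j)
     + tau_orbit x (jminus x N) = tau_orbit x (jplus x N))%N.
Proof.
apply: tau_sum_telescope (jplus_le_jminus x N) _ => j /tau_orbit_gt.
exact: leq_ltn_trans.
Qed.

(** Either the first term is [x] itself, or it is reached from above [2 * N] by a step that loses at
    most a third, plus 2. *)
Lemma tau_orbit_jplus_ge x N : (2 * N <= x)%N ->
  (4 * N <= 3 * tau_orbit x (jplus x N) + 6)%N.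
Proof.
case def_j: (jplus x N) => [|j] Nx; first by rewrite /tau_orbit /=; lia.
have : (2 * N < tau_orbit x j)%N.
  by apply: tau_orbit_gt; rewrite -/(jplus x N) def_j.
rewrite tau_orbitS; have := tau_leq_third (tau_orbit x j); lia.
Qed.

(** Three times the sum is at least [4N - 6 - 3N = N - 6], and [4(N - 6) >= 3N] exactly when
    [N >= 24]. *)
Lemma tau_sum_block_ge x N : (2 * N <= x)%N -> (24 <= N)%N ->
  (N <= 4 * \sum_(jplus x N <= j < jminus x N) tau (tau_orbit x j))%N.
Proof.
move=> /tau_orbit_jplus_ge; have := tau_sum_block x N.
have := tau_orbit_first_le x N; rewrite -/(jminus x N); lia.
Qed.

Lemma tau_sum_block_le x N :
  (\sum_(jplus x N <= j < jminus x N) tau (tau_orbit x j) <= 2 * N)%N.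
Proof.
have := tau_sum_block x N; have := tau_orbit_first_le x (2 * N).
rewrite -/(jplus x N); lia.
Qed.

(** * Mean and variance over the block *)

Lemma visits_tau_mean (R : realType) x N :
  (visits x N)%:R * tau_mean R x N =
  (\sum_(jplus x N <= j < jminus x N) tau (tau_orbit x j))%N%:R.
Proof.
(* Without visits the factor [visits] cannot be cancelled, but the sum is then empty. *)
rewrite /tau_mean natr_sum; case: (posnP (visits x N)) => [v0|v0].
  by rewrite v0 mul0r big_geq // -subn_eq0 -/(visits x N) v0.
by rewrite mulrA divff ?mul1r // pnatr_eq0 -lt0n.
Qed.

Lemma tau_mean_gt0 (R : realType) x N : (2 * N <= x)%N -> (24 <= N)%N ->
  0 < tau_mean R x N.
Proof.
move=> Nx N24; have SN := tau_sum_block_ge Nx N24.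
have : 0 < (visits x N)%:R * tau_mean R x N.
  by rewrite visits_tau_mean ltr0n; lia.
rewrite pmulr_rgt0 // ltr0n lt0n; apply: contraTneq SN => v0.
by rewrite big_geq -?subn_eq0 -?/(visits x N) ?v0 //; lia.
Qed.

Lemma visits_tau_var (R : realType) x N :
  (visits x N)%:R * tau_var R x N =
  \sum_(jplus x N <= j < jminus x N)
     ((tau (tau_orbit x j))%:R - tau_mean R x N) ^+ 2.
Proof.
rewrite /tau_var; case: (posnP (visits x N)) => [v0|v0].
  by rewrite v0 mul0r big_geq // -subn_eq0 -/(visits x N) v0.
by rewrite mulrA divff ?mul1r // pnatr_eq0 -lt0n.
Qed.

Lemma tau_var_ge0 (R : realType) x N : 0 <= tau_var R x N.
Proof. by rewrite mulr_ge0 ?invr_ge0 // sumr_ge0 // => j _; rewrite sqr_ge0. Qed.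

(** * The block as a decreasing sequence *)

Definition orbit_block (x N : nat) : seq nat :=
  [seq tau_orbit x j | j <- index_iota (jplus x N) (jminus x N)].

Lemma size_orbit_block x N : size (orbit_block x N) = visits x N.
Proof. by rewrite size_map size_iota. Qed.

Lemma nth_orbit_block x N i : (i < visits x N)%N ->
  nth 0%N (orbit_block x N) i = tau_orbit x (jplus x N + i).
Proof.
by move=> iV; rewrite (nth_map 0%N) ?size_iota // nth_iota.
Qed.

Lemma orbit_block_gt0 x N i : (i < visits x N)%N ->
  (0 < nth 0%N (orbit_block x N) i)%N.
Proof.
move=> iV; rewrite nth_orbit_block //.
apply: leq_ltn_trans (leq0n N) _; apply: tau_orbit_gt.
by move: iV; rewrite /visits -/(jminus x N); lia.
Qed.

Lemma nth_orbit_blockS x N i : (i.+1 < visits x N)%N ->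
  nth 0%N (orbit_block x N) i =
  (nth 0%N (orbit_block x N) i.+1 + tau (nth 0%N (orbit_block x N) i))%N.
Proof.
move=> iV; have := orbit_block_gt0 (ltnW iV).
rewrite !nth_orbit_block ?(ltnW iV) // addnS tau_orbitS => /tau_leq; lia.
Qed.

Lemma sorted_orbit_block x N : sorted gtn (orbit_block x N).
Proof.
apply/(sortedP 0%N) => i; rewrite size_orbit_block => iV /=.
by rewrite [ltnRHS]nth_orbit_blockS // -addn1 leq_add2l tau_gt0.
Qed.

Lemma mem_orbit_block x N y : y \in orbit_block x N ->
  (N < y <= 2 * N)%N /\ exists j, y = tau_orbit x j.
Proof.
case/mapP => j; rewrite mem_index_iota => /andP[pj jm] ->; split; last by exists j.
rewrite tau_orbit_gt //=.
exact: leq_trans (tau_orbit_anti _ pj) (tau_orbit_first_le _ _).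
Qed.

Lemma near_AP_at_orbit_block (R : realType) (T e : R) x N
    (i : 'I_(size (orbit_block x N))) :
  near_AP_at T e (orbit_block x N) i =
  (`|(tau (nth 0%N (orbit_block x N) i))%:R - T| <= e).
Proof.
rewrite /near_AP_at; case: (boolP (i.+1 < _)%N) => //= iV.
have {}iV : (i.+1 < visits x N)%N by rewrite -size_orbit_block.
set a := nth _ _ i.+1; set t := tau _.
have -> : a%:R - ((nth 0%N (orbit_block x N) i)%:R - T) = - (t%:R - T) :> R.
  by rewrite (nth_orbit_blockS iV) -/a -/t natrD; ring.
by rewrite normrN andbb.
Qed.

(** * Chebyshev's inequality and the count of exceptions *)

Lemma card_large_sqr (R : realType) (I : finType) (f : I -> R) (e : R) : 0 <= e ->
  #|[set i | ~~ (`|f i| <= e)]%SET|%:R * e ^+ 2 <= \sum_i f i ^+ 2.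
Proof.
move=> e0; rewrite mulr_natl -sumr_const.
rewrite [leRHS](bigID (mem [set i | ~~ (`|f i| <= e)]%SET)) /=.
apply: le_trans (_ : _ <= _ + 0) _; first by rewrite addr0.
apply: lerD; last by apply: sumr_ge0 => i _; rewrite sqr_ge0.
apply: ler_sum => i; rewrite inE -ltNge => /ltW ei.
by rewrite -[leRHS]real_normK ?num_real // ler_pXn2r ?nnegrE.
Qed.

(** Serves the case of zero variance, where the threshold is 0 and Chebyshev's inequality says
    nothing. *)
Lemma card_large_eq0 (R : realType) (I : finType) (f : I -> R) (e : R) : 0 <= e ->
  \sum_i f i ^+ 2 = 0 -> #|[set i | ~~ (`|f i| <= e)]%SET| = 0%N.
Proof.
move=> e0 /eqP; rewrite psumr_eq0 => [/allP f0|i _]; last by rewrite sqr_ge0.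
apply/eqP; rewrite cards_eq0; apply/eqP/setP => i; rewrite !inE.
have := f0 i (mem_index_enum i); rewrite /= sqrf_eq0 => /eqP ->.
by rewrite normr0 e0.
Qed.

Lemma num_exceptions_orbit_block (R : realType) x N (q : R) :
  0 < tau_mean R x N -> 0 <= q ->
  tau_var R x N = (q * tau_mean R x N) ^+ 2 ->
  (num_exceptions (tau_mean R x N) (tau_mean R x N * Num.sqrt q)
     (orbit_block x N))%:R <= q * (size (orbit_block x N))%:R.
Proof.
set T := tau_mean R x N; set s := orbit_block x N => T0 q0 varE.
set e := T * Num.sqrt q.
have e0 : 0 <= e by rewrite mulr_ge0 ?sqrtr_ge0 // ltW.
pose f (i : 'I_(size s)) : R := (tau (nth 0%N s i))%:R - T.
have -> : num_exceptions T e s = #|[set i | ~~ (`|f i| <= e)]%SET|.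
  by apply: eq_card => i; rewrite !inE near_AP_at_orbit_block.
have sumE : \sum_i f i ^+ 2 = (size s)%:R * (q * T) ^+ 2.
  rewrite -varE [in RHS]size_orbit_block visits_tau_var.
  rewrite -(big_map (tau_orbit x) xpredT (fun y => ((tau y)%:R - T) ^+ 2)).
  by rewrite -/(orbit_block x N) -/s (big_nth 0%N) big_mkord.
case: (ltrgtP 0 q) q0 => // [q0 _|q0 _]; last first.
  by rewrite card_large_eq0 ?sumE -?q0 ?mul0r // expr0n mulr0.
(* This is [e ^+ 2]; dividing the sum of squares [size s * (q * T) ^+ 2] by it leaves
   [q * size s]. *)
have Tq : 0 < T ^+ 2 * q by rewrite mulr_gt0 // exprn_gt0.
rewrite -(ler_pM2r Tq); have := card_large_sqr f e0.
rewrite sumE {2}/e !exprMn sqr_sqrtr ?(ltW q0) // => /le_trans; apply.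
by rewrite le_eqVlt; apply/orP; left; apply/eqP; ring.
Qed.

(* N -> oo along an arbitrary sequence N_k.  For a fixed starting point x the
   block (N, 2N] would eventually lie above the orbit, so x = x_k varies with
   N_k and only has to start at or above the block: 2 N_k <= x_k.  The constants
   in r \asymp N / T are absolute: independent of the sequences. *)
Theorem mainTheorem18 (R : realType) :
  exists c C : R, 0 < c /\ 0 < C /\
  forall x N : nat -> nat,
    (forall k, (1 <= N k)%N) ->
    (forall k, (2 * N k <= x k)%N) ->
    N @ \oo --> \oo ->
    (fun k => tau_var R (x k) (N k))
      =o_\oo (fun k => tau_mean R (x k) (N k) ^+ 2) ->
    exists m : nat -> seq nat,
      (forall k, sorted gtn (m k)
        /\ (forall y, y \in m k ->
              (N k < y <= 2 * N k)%N /\ exists j, y = tau_orbit (x k) j))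
      /\ (\forall k \near \oo,
            c * ((N k)%:R / tau_mean R (x k) (N k)) <= (size (m k))%:R
              <= C * ((N k)%:R / tau_mean R (x k) (N k)))
      /\ exists e : nat -> R,
           e =o_\oo (fun k => tau_mean R (x k) (N k)) /\
           (fun k => (num_exceptions (tau_mean R (x k) (N k)) (e k) (m k))%:R : R)
             =o_\oo (fun k => (size (m k))%:R : R).
Proof.
(* The sum of [tau] over the block is [visits * T] and lies between [N/4] and [2N] for [N >= 24]. *)
exists 4^-1, 2; split; first by rewrite invr_gt0.
split; first by [].
move=> x N _ Nx Noo var_o; exists (fun k => orbit_block (x k) (N k)).
pose T k := tau_mean R (x k) (N k).
have N_ge24 : \forall k \near \oo, (24 <= N k)%N.
  exact: (Noo _ (nbhs_infty_ge 24)).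
have T_gt0 : \forall k \near \oo, 0 < T k.
  by apply: filterS N_ge24 => k; exact: tau_mean_gt0.
split; first by move=> k; split; [exact: sorted_orbit_block|exact: mem_orbit_block].
split.
  apply: filterS N_ge24 => k N24; rewrite size_orbit_block.
  have T0 := tau_mean_gt0 R (Nx k) N24.
  rewrite !mulrA ler_pdivrMr // ler_pdivlMr // visits_tau_mean.
  rewrite -natrM ler_nat tau_sum_block_le andbT ler_pdivrMl // -natrM ler_nat.
  exact: tau_sum_block_ge.
pose q k : R := Num.sqrt (tau_var R (x k) (N k)) / T k.
have q_to0 (eps : R) : 0 < eps -> \forall k \near \oo, 0 <= q k <= eps.
  move=> eps0; have eps2 : 0 < eps ^+ 2 by rewrite exprn_gt0.
  move/eqoP: var_o => /(_ _ eps2); move: T_gt0; apply: filterS2 => k T0.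
  rewrite !ger0_norm ?tau_var_ge0 ?sqr_ge0 // => le.
  rewrite divr_ge0 ?sqrtr_ge0 ?(ltW T0) //= ler_pdivrMr //.
  have eT0 : 0 <= eps * T k by rewrite mulr_ge0 // ltW.
  by rewrite -(ger0_norm eT0) -sqrtr_sqr ler_wsqrtr // exprMn.
(* The square root balances both demands: [e / T = sqrt q] and the exceptional proportion [q] tend
   to 0 together, whereas [e = T q] would only bound that proportion by 1. *)
exists (fun k => T k * Num.sqrt (q k)); split.
  apply/eqoP => eps eps0; have eps2 : 0 < eps ^+ 2 by rewrite exprn_gt0.
  have := q_to0 _ eps2; apply: filterS => k /andP[q0 qe].
  rewrite normrM mulrC ler_wpM2r // ger0_norm ?sqrtr_ge0 //.
  by rewrite -(ger0_norm (ltW eps0)) -sqrtr_sqr ler_wsqrtr.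
apply/eqoP => eps eps0; have := q_to0 _ eps0; move: T_gt0.
apply: filterS2 => k T0 /andP[q0 qe].
rewrite !normr_nat; apply: le_trans (_ : _ <= q k * _) _; last first.
  exact: ler_wpM2r qe.
apply: num_exceptions_orbit_block => //.
by rewrite divfK ?gt_eqF // sqr_sqrtr // tau_var_ge0.
Qed.
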